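(* Let $m\in\mathbb N$. For every set $\Psi$ of at most $m$-ary relations with small projections on a finite set $C$, there exists a set $\Gamma$ of at most $m$-ary relations on a multisorted Boolean set such that $\mathrm{Pol}(\Psi)\sim\mathrm{Pol}(\Gamma)$. Conversely, for every set $\Gamma$ of at most $m$-ary relations on a multisorted Boolean set, there exists a set $\Psi$ of at most $m$-ary relations with small projections on a finite set such that $\mathrm{Pol}(\Gamma)\sim\mathrm{Pol}(\Psi)$.
   Context: A relation $R\subseteq C^r$ has small projections if its projection to each coordinate has at most two elements. For a set $\Psi$ of relations on $C$, $\mathrm{Pol}(\Psi)$ is the set of all finitary operations on $C$ preserving all relations in $\Psi$. A $k$-sorted Boolean set is $\mathbf A=(\{0,1\},\dots,\{0,1\})$ ($k$ copies, $k\in\mathbb N$). An $n$-ary operation on it is a tuple $(f_1,\dots,f_k)$ with $f_i:\{0,1\}^n\to\{0,1\}$. A relation of type $(i_1,\dots,i_r)$, $i_j\in[k]$, is a subset $R\subseteq\{0,1\}^r$ together with its type; $(f_1,\dots,f_k)$ preserves it if for any $n$ tuples $\mathbf r_1,\dots,\mathbf r_n\in R$ the tuple whose $j$th entry is $f_{i_j}(r_{1j},\dots,r_{nj})$ lies in $R$. $\mathrm{Pol}(\Gamma)$ is the set of operations preserving all relations in $\Gamma$. Both kinds of $\mathrm{Pol}$ are minions with the $n$-ary members as $n$-ary part and minor maps $\mathbf f\mapsto\mathbf f^{(\alpha)}$, $f_i^{(\alpha)}(a_1,\dots,a_p)=f_i(a_{\alpha(1)},\dots,a_{\alpha(n)})$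 for $\alpha:[n]\to[p]$. A minion homomorphism between such sets is a family of arity-preserving maps commuting with taking minors; $\mathcal M\sim\mathcal N$ means there are minion homomorphisms in both directions. *)

(* Defs.v *)
From mathcomp Require Import all_boot.

Set Implicit Arguments.
Unset Strict Implicit.
Unset Printing Implicit Defensive.

(* Tuples in X^n are finite functions on 'I_n. *)
Notation tup X n := {ffun 'I_n -> X}.

(* A family of operations (those satisfying [mem]) closed under minors.
   [op n] is the type of all n-ary operations of the kind considered. *)
Record minion := Minion {
  op : nat -> Type;
  minor : forall n p, ('I_n -> 'I_p) -> op n -> op p;
  mem : forall n, op n -> Prop;
  mem_minor : forall n p (a : 'I_n -> 'I_p) (f : op n),
    mem f -> mem (minor a f)
}.

Definition part (M : minion) (n : nat) : Type := {f : op M n | mem f}.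

(* Membership proofs are kept out of the minor condition: whenever the member
   g is the a-minor of the member f, xi g is the a-minor of xi f. *)
Definition is_minion_hom (M N : minion) (xi : forall n, part M n -> part N n) :
    Prop :=
  forall n p (a : 'I_n -> 'I_p) (f : part M n) (g : part M p),
    sval g = minor a (sval f) -> sval (xi p g) = minor a (sval (xi n f)).

Definition has_minion_hom (M N : minion) : Prop :=
  exists xi : forall n, part M n -> part N n, is_minion_hom xi.

Definition minion_equiv (M N : minion) : Prop :=
  has_minion_hom M N /\ has_minion_hom N M.

Section OneSorted.

Variable C : finType.

Definition operation (n : nat) := {ffun tup C n -> C}.

Definition op_minor n p (a : 'I_n -> 'I_p) (f : operation n) : operation p :=
  [ffun x : tup C p => f [ffun i => x (a i)]].

Definition preserves n (f : operation n) r (R : {set tup C r}) : Prop :=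
  forall s : 'I_n -> tup C r, (forall i, s i \in R) ->
    [ffun j => f [ffun i => s i j]] \in R.

(* A set of relations on C, of possibly different arities. *)
Definition relset := forall r, {set tup C r} -> Prop.

Definition at_most_ary (m : nat) (Psi : relset) : Prop :=
  forall r (R : {set tup C r}), Psi r R -> r <= m.

Definition small_projections r (R : {set tup C r}) : Prop :=
  forall j : 'I_r, #|[set t j | t : tup C r in R]| <= 2.

(* As usual for minions, operations have positive arity. *)
Definition in_Pol (Psi : relset) n (f : operation n) : Prop :=
  0 < n /\ forall r (R : {set tup C r}), Psi r R -> preserves f R.

Lemma in_Pol_minor (Psi : relset) n p (a : 'I_n -> 'I_p) (f : operation n) :
  in_Pol Psi f -> in_Pol Psi (op_minor a f).
Proof.
case=> n0 fP; split=> [|r R PR s sR].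
  exact: leq_ltn_trans (leq0n _) (ltn_ord (a (Ordinal n0))).
suff -> : [ffun j => op_minor a f [ffun i => s i j]] =
    [ffun j => f [ffun i => s (a i) j]].
  exact: fP r R PR (fun i => s (a i)) (fun i => sR (a i)).
apply/ffunP=> j; rewrite !ffunE; congr (fun_of_fin f _).
by apply/ffunP=> i; rewrite !ffunE.
Qed.

Definition Pol (Psi : relset) : minion :=
  @Minion operation op_minor (in_Pol Psi) (@in_Pol_minor Psi).

End OneSorted.

(* Operations on, and relations on, the k-sorted Boolean set. *)
Section MultisortedBoolean.

Variable k : nat.

Definition moperation (n : nat) := {ffun 'I_k -> operation bool n}.

Definition mop_minor n p (a : 'I_n -> 'I_p) (f : moperation n) :
    moperation p :=
  [ffun i => op_minor a (f i)].

(* R is a relation of type tau = (tau 0, ..., tau (r-1)). *)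
Definition mpreserves n (f : moperation n) r (tau : tup 'I_k r)
    (R : {set tup bool r}) : Prop :=
  forall s : 'I_n -> tup bool r, (forall i, s i \in R) ->
    [ffun j => f (tau j) [ffun i => s i j]] \in R.

Definition mrelset := forall r, tup 'I_k r -> {set tup bool r} -> Prop.

Definition mat_most_ary (m : nat) (Gamma : mrelset) : Prop :=
  forall r (tau : tup 'I_k r) (R : {set tup bool r}), Gamma r tau R -> r <= m.

Definition in_mPol (Gamma : mrelset) n (f : moperation n) : Prop :=
  0 < n /\ forall r (tau : tup 'I_k r) (R : {set tup bool r}),
    Gamma r tau R -> mpreserves f tau R.

Lemma in_mPol_minor (Gamma : mrelset) n p (a : 'I_n -> 'I_p)
    (f : moperation n) :
  in_mPol Gamma f -> in_mPol Gamma (mop_minor a f).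
Proof.
case=> n0 fP; split=> [|r tau R GR s sR].
  exact: leq_ltn_trans (leq0n _) (ltn_ord (a (Ordinal n0))).
suff -> : [ffun j => mop_minor a f (tau j) [ffun i => s i j]] =
    [ffun j => f (tau j) [ffun i => s (a i) j]].
  exact: fP r tau R GR (fun i => s (a i)) (fun i => sR (a i)).
apply/ffunP=> j; rewrite !ffunE; congr (fun_of_fin (f _) _).
by apply/ffunP=> i; rewrite !ffunE.
Qed.

Definition mPol (Gamma : mrelset) : minion :=
  @Minion moperation mop_minor (in_mPol Gamma) (@in_mPol_minor Gamma).

End MultisortedBoolean.

(* Main.v *)
Require Import Defs.
From mathcomp Require Import all_boot.
From mathcomp Require Import boolp.

Set Implicit Arguments.
Unset Strict Implicit.
Unset Printing Implicit Defensive.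

(** A minion with a constant member receives a homomorphism from every minion,
   so assume that there are no constants. Then the essential variables of a
   minor cannot lie in two disjoint sets.

   From Boolean relations: C is the disjoint union of the sorts (plus a junk
   element), and a multisorted operation acts on a tuple through the unique
   sort containing the essential variables of the minor along that tuple.

   From small projections: the sorts are the projections S of the relations,
   with elements numbered by bits. Translating the relations alone does not
   suffice. Singletons arising as S :&: T are added as unary relations, so
   that the values computed in S and in T agree, and an idempotent sort is
   added, so that no constant polymorphism appears. *)

(** * Sets of variables supporting a function *)

Section Support.

Variables (D B : finType) (V : eqType).
Implicit Types (S : {set D}) (g : {ffun {ffun D -> B} -> V}).

Definition supported S g : bool :=
  [forall y : {ffun D -> B}, forall z : {ffun D -> B},
    [forall d in S, y d == z d] ==> (g y == g z)].

Lemma supportedP S g :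
  reflect (forall y z : {ffun D -> B}, {in S, y =1 z} -> g y = g z)
          (supported S g).
Proof.
apply: (iffP forallP) => [gS y z yz|gS y].
  apply/eqP; move/forallP/(_ z)/implyP: (gS y); apply.
  by apply/forall_inP => d /yz ->.
apply/forallP => z; apply/implyP => /forall_inP yz.
by apply/eqP/gS => d /yz /eqP.
Qed.

(** Pass from [y] to [z] through the function equal to [y] on [S] and to [z] elsewhere: it agrees
    with [y] on [S] and with [z] on [T]. *)
Lemma supportedI S T g :
  supported S g -> supported T g -> supported (S :&: T) g.
Proof.
move=> /supportedP gS /supportedP gT; apply/supportedP => y z yz.
rewrite (gS y [ffun d => if d \in S then y d else z d]); last first.
  by move=> d dS; rewrite ffunE dS.
apply: gT => d dT; rewrite ffunE; case: ifP => // dS.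
by apply: yz; rewrite inE dS.
Qed.

Lemma supported0 g y z : supported set0 g -> g y = g z.
Proof. by move/supportedP; apply=> d; rewrite inE. Qed.

End Support.

(* [pull f x] and [mpull f x] are the minors of f along x : [n] -> D, with D
   as the set of variables. By the Yoneda lemma, every minion homomorphism
   into operations on D is a function of these minors. *)
Definition pull (C D : finType) n (f : operation C n) (x : tup D n) :
    {ffun {ffun D -> C} -> C} :=
  [ffun y : {ffun D -> C} => f [ffun l => y (x l)]].

Definition mpull k (D : finType) n (f : moperation k n) (x : tup D n) :
    {ffun {ffun D -> bool} -> {ffun 'I_k -> bool}} :=
  [ffun y : {ffun D -> bool} => [ffun s => f s [ffun l => y (x l)]]].

Lemma pull_minor (C D : finType) n p (a : 'I_n -> 'I_p) (f : operation C n)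
    (x : tup D p) :
  pull (op_minor a f) x = pull f [ffun l => x (a l)].
Proof.
apply/ffunP => y; rewrite !ffunE; congr (f _).
by apply/ffunP => l; rewrite !ffunE.
Qed.

Lemma mpull_minor k (D : finType) n p (a : 'I_n -> 'I_p) (f : moperation k n)
    (x : tup D p) :
  mpull (mop_minor a f) x = mpull f [ffun l => x (a l)].
Proof.
apply/ffunP => y; apply/ffunP => s; rewrite !ffunE; congr (f s _).
by apply/ffunP => l; rewrite !ffunE.
Qed.

Lemma supported_pull (C D : finType) n (f : operation C n) (x : tup D n)
    (S : {set D}) :
  (forall l, x l \in S) -> supported S (pull f x).
Proof.
move=> xS; apply/supportedP => y z yz; rewrite !ffunE; congr (f _).
by apply/ffunP => l; rewrite !ffunE yz.
Qed.

Lemma supported_mpull k (D : finType) n (f : moperation k n) (x : tup D n)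
    (S : {set D}) :
  (forall l, x l \in S) -> supported S (mpull f x).
Proof.
move=> xS; apply/supportedP => y z yz; apply/ffunP => s; rewrite !ffunE.
by congr (f s _); apply/ffunP => l; rewrite !ffunE yz.
Qed.

(** * Homomorphisms given by minors, and constant polymorphisms *)

Lemma hom_Pol_mPol (C : finType) k (Psi : relset C) (Gamma : mrelset k)
    (Phi : 'I_k -> {ffun {ffun bool -> C} -> C} -> bool) :
  (forall n (f : operation C n), in_Pol Psi f ->
     in_mPol Gamma [ffun s => [ffun t : tup bool n => Phi s (pull f t)]]) ->
  has_minion_hom (Pol Psi) (mPol Gamma).
Proof.
move=> PhiP.
exists (fun n (f : part (Pol Psi) n) => exist _ _ (PhiP n _ (svalP f))).
move=> n p a f g /= ->; apply/ffunP => s; rewrite !ffunE; apply/ffunP => t.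
by rewrite !ffunE pull_minor.
Qed.

Lemma hom_mPol_Pol (C : finType) k (Psi : relset C) (Gamma : mrelset k)
    (Phi : {ffun {ffun C -> bool} -> {ffun 'I_k -> bool}} -> C) :
  (forall n (f : moperation k n), in_mPol Gamma f ->
     in_Pol Psi [ffun x : tup C n => Phi (mpull f x)]) ->
  has_minion_hom (mPol Gamma) (Pol Psi).
Proof.
move=> PhiP.
exists (fun n (f : part (mPol Gamma) n) => exist _ _ (PhiP n _ (svalP f))).
by move=> n p a f g /= ->; apply/ffunP => x; rewrite !ffunE mpull_minor.
Qed.

Definition constant_pol (C : finType) (Psi : relset C) (v : C) : Prop :=
  forall r (R : {set tup C r}), Psi r R ->
    forall t, t \in R -> [ffun => v] \in R.

Definition constant_mpol k (Gamma : mrelset k) (c : {ffun 'I_k -> bool}) : Prop :=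
  forall r (tau : tup 'I_k r) (R : {set tup bool r}), Gamma r tau R ->
    forall t, t \in R -> [ffun j => c (tau j)] \in R.

(** Empty support allows the argument to be replaced, separately at each coordinate [j], by the
    constant [t j]; the resulting tuple is [f] applied to [n] copies of [t]. *)
Lemma constant_pol_pull (C D : finType) (Psi : relset C) n (f : operation C n)
    (x : tup D n) v :
  in_Pol Psi f -> supported set0 (pull f x) ->
  constant_pol Psi (pull f x [ffun => v]).
Proof.
move=> [_ fP] f0 r R PR t tR.
suff -> : [ffun => pull f x [ffun => v]] = [ffun j => f [ffun => t j]].
  have := fP r R PR (fun=> t) (fun=> tR).
  by congr (_ \in R); apply/ffunP => j; rewrite !ffunE.
apply/ffunP => j; rewrite !ffunE.
have := supported0 [ffun => v] [ffun => t j] f0; rewrite !ffunE => ->.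
by congr (f _); apply/ffunP => l; rewrite !ffunE.
Qed.

Lemma constant_mpol_mpull k (D : finType) (Gamma : mrelset k) n
    (f : moperation k n) (x : tup D n) y :
  in_mPol Gamma f -> supported set0 (mpull f x) ->
  constant_mpol Gamma (mpull f x y).
Proof.
move=> [_ fP] f0 r tau R GR t tR.
suff -> : [ffun j => mpull f x y (tau j)] = [ffun j => f (tau j) [ffun => t j]].
  have := fP r tau R GR (fun=> t) (fun=> tR).
  by congr (_ \in R); apply/ffunP => j; rewrite !ffunE.
apply/ffunP => j.
rewrite (ffunE _ j) (supported0 y [ffun => t j] f0) !ffunE; congr (f _ _).
by apply/ffunP => l; rewrite !ffunE.
Qed.

(** * From Boolean relations to small projections *)

Section FromBoolean.

Variables (k m : nat) (Gamma : mrelset k).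
Hypothesis Gamma_m : mat_most_ary m Gamma.

Let C : finType := option ('I_k * bool).

Definition tagged_rel : relset C := fun r Q =>
  exists (tau : tup 'I_k r) (R : {set tup bool r}), Gamma tau R /\
    Q = [set [ffun j => Some (tau j, (t : tup bool r) j)] | t in R].

Definition of_sort (i : 'I_k) : {set C} :=
  [set c : C | if c is Some p then p.1 == i else false].

Lemma tagged_rel_small r (Q : {set tup C r}) :
  tagged_rel Q -> small_projections Q.
Proof.
move=> [tau [R [_ ->]]] j.
apply: leq_trans (_ : #|[set Some (tau j, true); Some (tau j, false)]| <= 2).
  apply/subset_leq_card/subsetP => c /imsetP[_ /imsetP[t _ ->] ->].
  by rewrite ffunE !inE; case: (t j); rewrite eqxx ?orbT.
by rewrite cards2; case: eqP.
Qed.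

Lemma tagged_rel_hom : has_minion_hom (Pol tagged_rel) (mPol Gamma).
Proof.
(* Bits are tagged with the sort [i] and the tag of the result is dropped. The default is not
   reached on tuples of a relation in [Gamma], where results are tagged. *)
apply: (@hom_Pol_mPol _ _ _ _ (fun i g =>
  (odflt (i, false) (g [ffun b => Some (i, b)])).2)) => n f [n0 fP].
split=> // r tau R GR s sR.
have Rtag : tagged_rel [set [ffun j => Some (tau j, (t : tup bool r) j)] | t in R].
  by exists tau, R.
have /imsetP[t tR /ffunP ft] := fP r _ Rtag
  (fun i => [ffun j => Some (tau j, s i j)]) (fun i => imset_f _ (sR i)).
move: tR; congr (_ \in R); apply/ffunP => j.
have := ft j; rewrite !ffunE => fj.
suff -> : [ffun l => [ffun b => Some (tau j, b)] ([ffun i => s i j] l)] =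
    [ffun i => [ffun j => Some (tau j, s i j)] j] by rewrite fj.
by apply/ffunP => l; rewrite !ffunE.
Qed.

(* The arguments of an operation on C may mix sorts; the sort of the result is
   read off the essential variables of the minor, which are not all absent
   when there is no constant polymorphism. *)
Lemma hom_tagged_rel :
  (forall c, ~ constant_mpol Gamma c) ->
  has_minion_hom (mPol Gamma) (Pol tagged_rel).
Proof.
move=> nc.
pose bit : {ffun C -> bool} := [ffun c => if c is Some p then p.2 else false].
apply: (@hom_mPol_Pol _ _ _ _ (fun g =>
  omap (fun i => (i, g bit i)) [pick i | supported (of_sort i) g])) => n f fP.
have n0 := fP.1; split=> // r Q [tau [R [GR ->]]] s sQ.
have /fin_all_exists2[t tR st] i := imsetP (sQ i).
apply/imsetP; exists [ffun j => f (tau j) [ffun i => t i j]].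
  exact: fP.2.
apply/ffunP => j; rewrite !ffunE.
have sup : supported (of_sort (tau j)) (mpull f [ffun i => s i j]).
  by apply: supported_mpull => l; rewrite ffunE st ffunE inE eqxx.
case: pickP => [i isup|/(_ (tau j))]; last by rewrite sup.
have ->: i = tau j.
  apply/eqP; apply/negPn/negP => ij.
  apply: (nc (mpull f [ffun i => s i j] bit)).
  apply: constant_mpol_mpull => //.
  suff <- : of_sort i :&: of_sort (tau j) = set0 by exact: supportedI.
  apply/setP => -[[i' b]|]; rewrite !inE //=.
  by case: eqP => // ->; rewrite (negbTE ij).
rewrite /= !ffunE; congr (Some (_, f _ _)).
by apply/ffunP => l; rewrite !ffunE st !ffunE.
Qed.

Lemma small_of_boolean :
  exists (C : finType) (Psi : relset C),
    [/\ at_most_ary m Psi,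
        (forall r (R : {set tup C r}), Psi r R -> small_projections R) &
        minion_equiv (mPol Gamma) (Pol Psi)].
Proof.
case: (EM (exists c, constant_mpol Gamma c)) => [[c cP]|nc].
  (* A constant member makes the minion equivalent to all operations on one point. *)
  exists unit, (fun r R => False); split=> //; split.
    by apply: (@hom_mPol_Pol _ _ _ _ (fun=> tt)) => n f [].
  apply: (@hom_Pol_mPol _ _ _ _ (fun s _ => c s)) => n f [n0 _].
  split=> // r tau R GR s sR.
  have := cP r tau R GR _ (sR (Ordinal n0)).
  by congr (_ \in R); apply/ffunP => j; rewrite !ffunE.
exists C, tagged_rel; split.
- by move=> r Q [tau [R [/Gamma_m]]].
- exact: tagged_rel_small.
split; last exact: tagged_rel_hom.
by apply: hom_tagged_rel => c cP; apply: nc; exists c.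
Qed.

End FromBoolean.

(** * From small projections to Boolean relations *)

Section FromSmall.

Variables (m : nat) (C : finType) (Psi : relset C).
Hypothesis Psi_m : at_most_ary m Psi.
Hypothesis Psi_small :
  forall r (R : {set tup C r}), Psi R -> small_projections R.

Definition proj r (R : {set tup C r}) (j : 'I_r) : {set C} :=
  [set t j | t : tup C r in R].

Definition projections : {set {set C}} :=
  [set S | `[< exists r (R : {set tup C r}) j, Psi R /\ S = proj R j >]].

Lemma projectionsP S :
  reflect (exists r (R : {set tup C r}) j, Psi R /\ S = proj R j)
          (S \in projections).
Proof. by rewrite inE; exact: asboolP. Qed.

Lemma card_projections S : S \in projections -> #|S| <= 2.
Proof. by case/projectionsP=> r [R [j [/Psi_small RS ->]]]; exact: RS. Qed.

Lemma Pol_projections n (f : operation C n) S (x : tup C n) :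
  in_Pol Psi f -> S \in projections -> (forall l, x l \in S) -> f x \in S.
Proof.
move=> [_ fP] /projectionsP[r [R [j [PR ->]]]] xS.
have /fin_all_exists2[t tR xt] l := imsetP (xS l).
apply/imsetP; exists [ffun j => f [ffun l => t l j]]; first exact: fP.
by rewrite ffunE; congr (f _); apply/ffunP => l; rewrite ffunE.
Qed.

Variable x0 : C.

(** For a singleton [S] the bit [true] decodes to [x0], possibly outside [S]; it is enough that
    [decode S] inverts [encode S] on [S]. *)
Definition decode (S : {set C}) : {ffun bool -> C} :=
  [ffun b : bool => nth x0 (enum S) b].

Definition encode (S : {set C}) : {ffun C -> bool} :=
  [ffun c => index c (enum S) == 1].

Lemma encodeK (S : {set C}) c : #|S| <= 2 -> c \in S -> decode S (encode S c) = c.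
Proof.
move=> S2 cS; rewrite !ffunE.
suff -> : (index c (enum S) == 1) = index c (enum S) :> nat.
  by rewrite nth_index // mem_enum.
have : index c (enum S) < 2.
  by apply: leq_trans S2; rewrite cardE index_mem mem_enum.
by case: (index _ _) => [|[]].
Qed.

(* The sorts are the subsets of C, of which only the projections of relations
   matter, and an additional sort [None] whose operations are idempotent. *)
Let k := #|{: option {set C}}|.
Let sort (S : option {set C}) : 'I_k := enum_rank S.

Definition fixed_bit (S : option {set C}) (b : bool) : Prop :=
  if S is Some U then
    exists T c, [/\ U \in projections, T \in projections, U :&: T = [set c] &
                    b = encode U c]
  else True.

(** Bits are fixed by constant tuples of any arity up to [m], so the arity bound holds even for
    [m = 0]; arity 1 is the instance exploited later. *)
Definition encoded_rel : mrelset k := fun r tau Q => r <= m /\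
  ((exists R : {set tup C r},
      [/\ Psi R, tau = [ffun j => sort (Some (proj R j))] &
          Q = [set t : tup bool r | [ffun j => decode (proj R j) (t j)] \in R]]) \/
   (exists S b,
      [/\ fixed_bit S b, tau = [ffun => sort S] & Q = [set [ffun => b]]])).

Lemma fixed_bit_mpreserved n (f : moperation k n) S b :
  0 < m -> in_mPol encoded_rel f -> fixed_bit S b ->
  f (sort S) [ffun => b] = b.
Proof.
move=> m0 [_ fP] Sb.
have G1 : @encoded_rel 1 [ffun => sort S] [set [ffun => b]].
  by split=> //; right; exists S, b.
have := fP _ _ _ G1 (fun=> [ffun => b]) (fun=> set11 _).
move/set1P/ffunP/(_ ord0); rewrite !ffunE => {2}<-.
by congr (f _ _); apply/ffunP => l; rewrite !ffunE.
Qed.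

(* Without constants, a minor of f to the variables {false, true} depends on
   at least one of them, so declaring its value to be [true] when it does not
   depend on [false] yields an idempotent operation. *)
Lemma hom_encoded_rel :
  (forall v, ~ constant_pol Psi v) ->
  has_minion_hom (Pol Psi) (mPol encoded_rel).
Proof.
move=> nc.
apply: (@hom_Pol_mPol _ _ _ _ (fun s g =>
  if enum_val s is Some U then encode U (g (decode U))
  else supported [set true] g)) => n f fP.
have n0 := fP.1; split=> // r tau Q [_ [[R [PR -> ->]]|[S [b [Sb -> ->]]]]] s sQ.
  rewrite inE.
  have := fP.2 r R PR (fun i => [ffun j => decode (proj R j) (s i j)]).
  set z := [ffun j => f _] => zR; have {}zR : z \in R.
    by apply: zR => i; have := sQ i; rewrite inE.
  move: (zR); congr (_ \in R); apply/ffunP => j; rewrite [RHS]ffunE.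
  have Sj : proj R j \in projections by apply/projectionsP; exists r, R, j.
  rewrite -[LHS](encodeK (card_projections Sj)); last exact: imset_f.
  congr (decode _ _); set lhs := LHS; rewrite !ffunE enum_rankK /lhs.
  congr (encode _ _); rewrite ffunE [RHS]ffunE; congr (f _).
  by apply/ffunP => i; rewrite !ffunE.
have {}sQ i : s i = [ffun => b] by apply/set1P.
apply/set1P/ffunP => j; rewrite !ffunE enum_rankK.
case: S Sb => [S [T [c [SP TP ST bE]]]|_].
  have cST : c \in S :&: T by rewrite ST set11.
  have [cS cT] := setIP cST.
  rewrite bE; congr (encode _ _); rewrite ffunE.
  set z := [ffun l => _]; have zc l : z l = c.
    rewrite -[RHS](encodeK (card_projections SP) cS) -bE /z ffunE.
    by congr (decode _ _); rewrite ffunE sQ ffunE.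
  (* All arguments equal [c] and [f] preserves both projections, so the value lies in their
     intersection. *)
  apply/set1P; rewrite -ST inE.
  by rewrite !(Pol_projections fP) // => l; rewrite zc.
have sup : supported [set b] (pull f [ffun i => s i j]).
  by apply: supported_pull => l; rewrite !ffunE sQ ffunE set11.
case: b sup {sQ} => // sup; apply/negbTE/negP => sup'.
apply: (nc _ (constant_pol_pull (x := [ffun i => s i j]) x0 fP _)).
suff <- : [set true] :&: [set false] = set0 by exact: supportedI.
by apply/setP => -[]; rewrite !inE.
Qed.

(** On the idempotent sort [None] a constant would have to equal both bits. *)
Lemma constant_encoded_rel c : 0 < m -> ~ constant_mpol encoded_rel c.
Proof.
move=> m0 cP.
have bE b : c (sort None) = b.
  have G1 : @encoded_rel 1 [ffun => sort None] [set [ffun => b]].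
    by split=> //; right; exists None, b.
  by move/set1P/ffunP/(_ ord0): (cP _ _ _ G1 _ (set11 _)); rewrite !ffunE.
by have := bE true; rewrite (bE false).
Qed.

(* If two projections S and T both support the minor, then S :&: T does, so it
   is nonempty; when S != T it is a singleton [set c], and the unary relations
   of [encoded_rel] force the value c. *)
Lemma decode_supported n (f : moperation k n) (x : tup C n) S T :
  0 < m -> in_mPol encoded_rel f -> S \in projections -> T \in projections ->
  supported S (mpull f x) -> supported T (mpull f x) ->
  decode S (mpull f x (encode S) (sort (Some S))) =
  decode T (mpull f x (encode T) (sort (Some T))).
Proof.
move=> m0 fP SP TP Ssup Tsup.
have [->//|ST] := eqVneq S T.
have STsup := supportedI Ssup Tsup.
have [ST0|[c cST]] := set_0Vmem (S :&: T).
  rewrite ST0 in STsup.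
  by case: (constant_encoded_rel m0 (constant_mpol_mpull [ffun => true] fP STsup)).
(* Projections have at most two elements, so a second common point would force [S = T]. *)
have STc : S :&: T = [set c].
  apply/esym/eqP; rewrite eqEcard sub1set cST cards1 leqNgt; apply/negP => ST2.
  move/negP: ST; apply; apply/eqP.
  rewrite -[LHS](_ : S :&: T = S); last first.
    by apply/eqP; rewrite eqEcard subsetIl (leq_trans (card_projections SP)).
  by apply/eqP; rewrite eqEcard subsetIr (leq_trans (card_projections TP)).
suff val U V : U \in projections -> V \in projections -> U :&: V = [set c] ->
    supported [set c] (mpull f x) ->
    decode U (mpull f x (encode U) (sort (Some U))) = c.
  rewrite STc in STsup; rewrite (val S T) // (val T S) // setIC //.
move=> UP VP UVc /supportedP csup.
have cU : c \in U by have := set11 c; rewrite -UVc => /setIP[].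
rewrite -[RHS](encodeK (card_projections UP) cU); congr (decode U _).
rewrite (csup _ [ffun => encode U c]); last by move=> _ /set1P ->; rewrite [RHS]ffunE.
rewrite -[RHS](fixed_bit_mpreserved (S := Some U) m0 fP); last by exists V, c.
by rewrite !ffunE; congr (f _ _); apply/ffunP => l; rewrite !ffunE.
Qed.

Lemma encoded_rel_hom : has_minion_hom (mPol encoded_rel) (Pol Psi).
Proof.
pose val (g : {ffun {ffun C -> bool} -> {ffun 'I_k -> bool}}) S :=
  decode S (g (encode S) (sort (Some S))).
(* The image takes the value on which all supporting projections agree, and an arbitrary one if no
   projection supports the minor. *)
apply: (@hom_mPol_Pol _ _ _ _ (fun g =>
  odflt x0 [pick v | [forall S in projections, supported S g ==> (v == val g S)]]))
  => n f fP.
have n0 := fP.1; split=> // r R PR s sR.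
have Sj j : proj R j \in projections by apply/projectionsP; exists r, R, j.
have sS i j : s i j \in proj R j by exact: imset_f.
have G : @encoded_rel r [ffun j => sort (Some (proj R j))]
    [set t : tup bool r | [ffun j => decode (proj R j) (t j)] \in R].
  by split; [exact: Psi_m PR | left; exists R].
have := fP.2 _ _ _ G (fun i => [ffun j => encode (proj R j) (s i j)]).
set z := [ffun j => f _ _] => zR; have {}zR : z \in [set t |
    [ffun j => decode (proj R j) ((t : tup bool r) j)] \in R].
  apply: zR => i; rewrite inE; move: (sR i); congr (_ \in R).
  apply/ffunP => j; rewrite [RHS]ffunE.
  rewrite -[LHS](encodeK (card_projections (Sj j)) (sS i j)).
  by congr (decode _ _); rewrite [RHS]ffunE.
move: zR; rewrite inE; congr (_ \in R); apply/ffunP => j.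
(* The coordinate [j] witnesses positive arity, so unary relations are within the bound. *)
have m0 : 0 < m by apply: leq_trans (Psi_m PR); exact: leq_ltn_trans (ltn_ord j).
pose x : tup C n := [ffun i => s i j].
have sup : supported (proj R j) (mpull f x).
  by apply: supported_mpull => l; rewrite ffunE.
rewrite ffunE [RHS]ffunE [RHS]ffunE -/x.
have -> : z j = mpull f x (encode (proj R j)) (sort (Some (proj R j))).
  by rewrite !ffunE; congr (f _ _); apply/ffunP => l; rewrite !ffunE.
case: pickP => [v /forall_inP/(_ _ (Sj j))|/(_ (val (mpull f x) (proj R j)))].
  by rewrite sup => /eqP ->.
case/negP; apply/forall_inP => S SP; apply/implyP => Ssup.
by apply/eqP; exact: decode_supported.
Qed.

End FromSmall.

(** * Degenerate cases and conclusion *)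

Lemma boolean_of_small (m : nat) (C : finType) (Psi : relset C) :
  at_most_ary m Psi ->
  (forall r (R : {set tup C r}), Psi r R -> small_projections R) ->
  exists (k : nat) (Gamma : mrelset k),
    [/\ 0 < k, mat_most_ary m Gamma & minion_equiv (Pol Psi) (mPol Gamma)].
Proof.
move=> Psi_m Psi_small.
have toT : has_minion_hom (Pol Psi) (mPol (fun r (_ : tup 'I_1 r) _ => False)).
  by apply: (@hom_Pol_mPol _ _ _ _ (fun _ _ => true)) => n f [].
case: (pickP (fun _ : C => true)) => [x0 _|C0]; last first.
  exists 1, (fun r _ _ => False); split=> //; split=> //.
  (* On empty [C], a projection to the first variable can be the image of any member: operations of
     equal positive arity coincide there, so minors are respected. *)
  have projP n (n0 : 0 < n) :
      in_Pol Psi [ffun x : tup C n => x (Ordinal n0)].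
    split=> // r R PR s sR; move: (sR (Ordinal n0)); congr (_ \in R).
    by apply/ffunP => j; rewrite !ffunE.
  have pos n : part (mPol (fun r (_ : tup 'I_1 r) _ => False)) n -> 0 < n.
    by case=> f [].
  exists (fun n f => exist _ _ (projP n (pos n f))) => n p a f g _ /=.
  by apply/ffunP => x; have := C0 (x (Ordinal (pos p g))).
case: (EM (exists v, constant_pol Psi v)) => [[v vP]|nc].
  exists 1, (fun r _ _ => False); split=> //; split=> //.
  apply: (@hom_mPol_Pol _ _ _ _ (fun=> v)) => n f [n0 _].
  split=> // r R PR s sR; have := vP r R PR _ (sR (Ordinal n0)).
  by congr (_ \in R); apply/ffunP => j; rewrite !ffunE.
exists #|{: option {set C}}|, (encoded_rel m Psi x0); split.
- by apply/card_gt0P; exists None.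
- by move=> r tau Q [].
split; last exact: encoded_rel_hom.
by apply: hom_encoded_rel => // v vP; apply: nc; exists v.
Qed.

Theorem theorem5p2 (m : nat) :
  (forall (C : finType) (Psi : relset C),
     at_most_ary m Psi ->
     (forall r (R : {set tup C r}), Psi r R -> small_projections R) ->
     exists (k : nat) (Gamma : mrelset k),
       [/\ 0 < k, mat_most_ary m Gamma &
           minion_equiv (Pol Psi) (mPol Gamma)])
  /\
  (forall (k : nat) (Gamma : mrelset k),
     mat_most_ary m Gamma ->
     exists (C : finType) (Psi : relset C),
       [/\ at_most_ary m Psi,
           (forall r (R : {set tup C r}), Psi r R -> small_projections R) &
           minion_equiv (mPol Gamma) (Pol Psi)]).
Proof.
split=> [C Psi|k Gamma]; [exact: boolean_of_small | exact: small_of_boolean].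
Qed.
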